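(* Let $G$ be a group whose cardinality $\kappa=|G|$ is a singular cardinal. Then the following statements hold: (i) if a subset $A$ of $G$ is left $\kappa$-thick, then $A$ is right $\kappa$-large; (ii) $G$ cannot be partitioned into two $\kappa$-thick subsets; (iii) if $G$ is $\kappa$-normal then, for every finite partition $G=A_1\cup\dots\cup A_n$, at least one cell $A_i$ is $\kappa$-large.
   Context: Let $G$ be a group and let $\kappa$ be a cardinal with $\kappa\le|G|$. $[G]^{<\kappa}$ denotes the family of all subsets of $G$ of cardinality $<\kappa$. An infinite cardinal $\kappa$ is regular if its cofinality equals $\kappa$, and singular otherwise. A subset $A$ of $G$ is called: - left $\kappa$-thick if for every $F\in[G]^{<\kappa}$ there exists $a\in A$ such that $Fa\subseteq A$; - $\kappa$-thick if for every $F\in[G]^{<\kappa}$ there exists $a\in A$ such that $FaF\subseteq A$; - right $\kappa$-large if there exists $F\in[G]^{<\kappa}$ such that $G=AF$; - $\kappa$-large if there exists $F\in[G]^{<\kappa}$ such that $G=FAF$. For an infinite group $G$ and an infinite cardinal $\kappa\le|G|$, $G$ is called $\kappa$-normal if every subset $F\in[G]^{<\kappa}$ is contained in some normal subgroup $H$ of $G$ with $H\in[G]^{<\kappa}$. *)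

(* Defs.v *)
From mathcomp Require Import all_boot.
From mathcomp Require Import boolp classical_sets functions cardinality.
From mathcomp Require Import wochoice.

Set Implicit Arguments.
Unset Strict Implicit.
Unset Printing Implicit Defensive.

Local Open Scope classical_set_scope.
Local Open Scope card_scope.

Definition card_lt T U (A : set T) (B : set U) := (A #<= B) && (A #!= B).
Notation "A '#<' B" := (card_lt A B) (at level 79) : card_scope.

(* A cardinal is an initial ordinal: a well-ordered type all of whose proper
   initial segments have strictly smaller cardinality.  Cardinals are compared
   through [#<=], [#=] and [#<] on their full sets. *)
Record cardinal := Cardinal {
  csort :> choiceType;
  cle : rel csort;
  cle_wo : well_order cle;
  cle_initial : forall x : csort,
    [set y | cle y x /\ y <> x] #< [set: csort]
}.

Definition cofinal (kappa : cardinal) (C : set kappa) :=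
  forall x, exists2 y, C y & cle x y.

Definition is_cofinality (kappa lambda : cardinal) :=
  (exists2 C : set kappa, cofinal C & C #= [set: lambda]) /\
  (forall C : set kappa, cofinal C -> [set: lambda] #<= C).

Definition regular (kappa : cardinal) :=
  infinite_set [set: kappa] /\ is_cofinality kappa kappa.

Definition singular (kappa : cardinal) :=
  infinite_set [set: kappa] /\ ~ regular kappa.

Section Groups.
Variable G : groupType.
Implicit Types (A B F H : set G) (kappa : cardinal).

Definition mulset A B : set G := [set (a * b)%g | a in A & b in B].

(* The family [G]^{<kappa}. *)
Definition small_sets kappa : set (set G) := [set F | F #< [set: kappa]].

Definition left_thick kappa A :=
  forall F, small_sets kappa F ->
  exists2 a, A a & mulset F [set a] `<=` A.

Definition thick kappa A :=
  forall F, small_sets kappa F ->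
  exists2 a, A a & mulset (mulset F [set a]) F `<=` A.

Definition right_large kappa A :=
  exists2 F, small_sets kappa F & [set: G] = mulset A F.

Definition large kappa A :=
  exists2 F, small_sets kappa F & [set: G] = mulset (mulset F A) F.

Definition normal_subgroup H :=
  group_closed (mem H) /\ (forall h g, H h -> H (conjg h g)).

End Groups.

Definition normal_group (kappa : cardinal) (G : groupType) :=
  forall F : set G, small_sets kappa F ->
  exists H : set G, [/\ normal_subgroup H, small_sets kappa H & F `<=` H].

(* Main.v *)
Require Import Defs.
From mathcomp Require Import all_boot.
From mathcomp Require Import boolp classical_sets functions cardinality.

(** Call a subset of [G] small if its cardinality is below [kappa].  Singularity
    provides a cofinal set [C] of indices with [#|C| < kappa].  Enumerating [G]
    along [kappa], the initial segments [H c], for [c] in [C], are small and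
    cover [G].  If [A] is left [kappa]-thick, then each [H c] has a right
    translate [H c * a c] inside [A], so that [H c] lies in [A * (a c)^-1].
    Hence [G = A * F] for the small set [F] of all the [(a c)^-1]: this is
    [left_thick_right_large].

    The other two parts combine this with the duality between large and thick
    sets: a large set meets every thick set ([thick_meets_large]), and the
    complement of a set that is not large is thick ([not_large_thick]).  Two
    thick cells of a partition are impossible, because the first one would be
    right large, hence large, and so would meet the second one.

    For a cover by finitely many sets [A i], induct on their number
    ([finite_cover_large]).  If [A 0] is not large, then its complement is
    thick, hence right large: [G] is the product of this complement and a small
    set [F].  So the sets [A i * F] with [i > 0] cover [G].  One of them is
    large by induction, say [G = F' * A i * F * F'], and then [A i] is large
    as soon as [F'] and [F * F'] lie in a common small set.  In a
    [kappa]-normal group a small normal subgroup that contains [F] and [F'] is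
    such a set; it exists since the union of two small sets is small, for which
    [small_setU_normal] gives a group-theoretic proof. *)

Set Implicit Arguments.
Unset Strict Implicit.
Unset Printing Implicit Defensive.

Local Open Scope classical_set_scope.
Local Open Scope card_scope.

(** * Comparison of cardinalities *)

Lemma inj_on_card_le (T U : Type) (A : set T) (B : set U) (f : T -> U) :
  set_fun A B f -> set_inj A f -> A #<= B.
Proof.
move=> fAB finj.
have [g] : $|{injfun A >-> B}| by apply/injfunPex; exists f.
exact: inj_card_le g.
Qed.

(** Keeping [A] and [B] in one type makes the injection a function on [T] even
    when [B] and hence [A] are empty. *)
Lemma card_le_inj_on (T : Type) (A B : set T) :
  A #<= B -> exists2 f : T -> T, set_fun A B f & set_inj A f.
Proof.
elim/Ppointed: T => T in A B *.
  by exists id => // x; have : [set: T] x by []; rewrite !emptyE.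
by move=> /pcard_leP/injfunPex.
Qed.

(** Zorn's lemma on the graphs of partial injections from [A] to [B]: a maximal
    graph is total on [A] or onto [B], since otherwise a pair of unused points
    could be added to it. *)
Lemma card_le_total (T : Type) (A B : set T) : (A #<= B) || (B #<= A).
Proof.
pose P (R : set (T * T)) :=
  (forall x y, R (x, y) -> A x /\ B y) /\
  (forall x y x' y', R (x, y) -> R (x', y') -> x = x' <-> y = y').
have [F FP Ftot|R [[RAB Rinj] maxR]] := @Zorn_bigcup _ P.
  split=> [x y [R /FP[RAB _] /RAB//]|x y x' y' [R FR Rxy] [S FS Sxy]].
  have [RS|SR] := Ftot _ _ FR FS.
    by have [_] := FP _ FS; apply; [exact: RS|].
  by have [_] := FP _ FR; apply; [|exact: SR].
have [domR|/existsNP[a /not_implyP[Aa aNR]]] :=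
    pselect (forall x, A x -> exists y, R (x, y)).
  have /choice[f fR] : forall x, exists y, A x -> R (x, y).
    by move=> x; have [/domR[y]|] := pselect (A x); [exists y|exists x].
  apply/orP; left; apply: (@inj_on_card_le _ _ _ _ f) => [x /fR/RAB[]//|].
  by move=> x y /set_mem/fR Rx /set_mem/fR Ry; apply: (Rinj _ _ _ _ Rx Ry).2.
have ranR y : B y -> exists x, R (x, y).
  move=> By; apply: contrapT => yNR.
  apply: (maxR (R `|` [set (a, y)])).
    split; first by left.
    by move=> /(_ (a, y) (or_intror erefl)) Ray; apply: aNR; exists y.
  split=> [u v [/RAB//|[-> ->]//]|u v u' v' [Ruv|[-> ->]] [Ruv'|[-> ->]] //].
  - exact: Rinj.
  - by split=> E; [case: aNR; exists v; rewrite -E|case: yNR; exists u; rewrite -E].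
  - by split=> E; [case: aNR; exists v'; rewrite E|case: yNR; exists u'; rewrite E].
have /choice[g gR] : forall y, exists x, B y -> R (x, y).
  by move=> y; have [/ranR[x]|] := pselect (B y); [exists x|exists y].
apply/orP; right; apply: (@inj_on_card_le _ _ _ _ g) => [y /gR/RAB[]//|].
by move=> x y /set_mem/gR Rx /set_mem/gR Ry; apply: (Rinj _ _ _ _ Rx Ry).1.
Qed.

Lemma card_le_lt_trans (T U V : Type) (A : set T) (B : set U) (C : set V) :
  A #<= B -> B #< C -> A #< C.
Proof.
move=> leAB /andP[leBC neBC]; apply/andP; split; first exact: card_le_trans leBC.
apply: contra neBC => eqAC; rewrite card_eq_le leBC.
by rewrite -(card_le_eql eqAC).
Qed.

(** Hilbert's hotel: along an injective sequence [d] that starts at [x] and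
    continues in [A], move each [d n] to [d n.+1]. *)
Lemma card_setU1_infinite (T : Type) (A : set T) (x : T) :
  infinite_set A -> A `|` [set x] #<= A.
Proof.
have [Ax _|NAx] := pselect (A x); first by apply: subset_card_le => y [|->].
move=> /infiniteP; elim/Ppointed: T => T in A x NAx *.
  by have : [set: T] x by []; rewrite emptyE.
move=> /pcard_leP/injfunPex[e eA /in2TT einj].
pose d n := if n is m.+1 then e m else x.
have dinj : injective d.
  move=> [|m] [|n] //= E; last by rewrite (einj _ _ E).
    by case: NAx; rewrite E; exact: eA.
  by case: NAx; rewrite -E; exact: eA.
have /choice[h hP] y : exists z,
    (exists2 n, y = d n & z = d n.+1) \/ (~ (exists n, y = d n) /\ z = y).
  have [[n yE]|yN] := pselect (exists n, y = d n); last by exists y; right.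
  by exists (d n.+1); left; exists n.
apply: (@inj_on_card_le _ _ _ _ h) => [y Ay|y z _ _].
  have [[n _ ->]|[yN ->]] := hP y; first exact: eA.
  by case: Ay => // yx; case: yN; exists 0%N.
have [[m -> ->]|[yN ->]] := hP y; have [[n -> ->]|[zN ->]] := hP z => //.
- by move=> /dinj[->].
- by move=> zE; case: zN; exists m.+1.
- by move=> yE; case: yN; exists n.+1.
Qed.

Lemma finite_card_lt (T U : Type) (A : set T) (B : set U) :
  finite_set A -> infinite_set B -> A #< B.
Proof.
move=> Afin Binf; apply/andP; split.
  apply: card_le_trans (finite_set_countable Afin) _; exact/infiniteP.
by apply/negP => AB; apply: Binf; rewrite -(eq_finite_set AB).
Qed.

Lemma card_setU1_lt (T U : Type) (A : set T) (x : T) (B : set U) :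
  infinite_set B -> A #< B -> A `|` [set x] #< B.
Proof.
move=> Binf AB; have [Afin|Ainf] := pselect (finite_set A).
  by apply: finite_card_lt => //; rewrite finite_setU.
exact: card_le_lt_trans (card_setU1_infinite x Ainf) AB.
Qed.

(** * Segments and cofinality of a cardinal *)

Section Cofinality.
Variable kappa : cardinal.

Lemma cle_refl : reflexive (@cle kappa).
Proof.
move=> x; have [|z [[/eqP-> lbx] _]] := cle_wo (A := pred1 x).
  by exists x; exact: eqxx.
by apply: lbx; exact: eqxx.
Qed.

(** Strict segments are below [kappa] by definition; adding the end point keeps
    them there because [kappa] is infinite. *)
Lemma segment_lt (x : kappa) : infinite_set [set: kappa] ->
  [set y | cle y x] #< [set: kappa].
Proof.
move=> kinf; apply: card_le_lt_trans (card_setU1_lt x kinf (cle_initial x)).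
apply: subset_card_le => y /= yx.
by have [->|] := pselect (y = x); [right|left].
Qed.

Lemma singular_cofinal : singular kappa ->
  exists2 C : set kappa, cofinal C & C #< [set: kappa].
Proof.
move=> [kinf nreg]; apply: contrapT => nC; apply: nreg; split=> //; split.
  by exists [set: kappa] => // x; exists x => //; exact: cle_refl.
move=> C cofC; apply: contrapT => leC; apply: nC; exists C => //.
apply/andP; split; first exact: card_leT.
by apply/negP; rewrite card_eq_le => /andP[_ /leC].
Qed.
End Cofinality.

(** * Duality between large and thick sets *)

Section Thick.
Variables (G : groupType) (kappa : cardinal).
Hypotheses (kinf : infinite_set [set: kappa]).
Implicit Types A B F H : set G.
Local Open Scope group_scope.

Lemma small_setU1 F x : small_sets kappa F -> small_sets kappa (F `|` [set x]).
Proof. exact: card_setU1_lt. Qed.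

Lemma small_invg F : small_sets kappa F -> small_sets kappa [set x^-1 | x in F].
Proof. exact: card_le_lt_trans (card_image_le _ _). Qed.

(** Thickness for the set [F] with [1] added gives [F a 1] inside [A]. *)
Lemma thick_left_thick A : thick kappa A -> left_thick kappa A.
Proof.
move=> thA F /(small_setU1 1)/thA[a Aa FaF]; exists a => // _ [f Ff [_ -> <-]].
apply: FaF; exists (f * a); last by exists 1; [right|rewrite mulg1].
by exists f; [left|exists a].
Qed.

Lemma right_large_large A : right_large kappa A -> large kappa A.
Proof.
move=> [F Fs AF]; exists (F `|` [set 1]); first exact: small_setU1.
apply/seteqP; split=> // g; rewrite AF => -[a Aa [f Ff <-]].
by exists a; [exists 1; [right|exists a; rewrite ?mul1g]|exists f; [left|]].
Qed.

(** If [G = F A F] and [F^-1 b F^-1] lies in [B], then writing [b = f a f']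
    puts [a = f^-1 b f'^-1] in both sets. *)
Lemma thick_meets_large A B : large kappa A -> thick kappa B ->
  exists2 a, A a & B a.
Proof.
move=> [F Fs GE] thB; have [b Bb FbF] := thB _ (small_invg Fs).
have : [set: G] b by []; rewrite GE => -[_ [f Ff [a Aa <-]] [f' Ff' bE]].
exists a => //; apply: FbF; exists (f^-1 * b).
  by exists f^-1; [exists f|exists b].
by exists f'^-1; [exists f'|rewrite -bE !mulgA mulVg mul1g mulgK].
Qed.

(** For small [F], some [b] lies outside [F^-1 A F^-1], which says that [F b F]
    avoids [A]. *)
Lemma not_large_thick A : ~ large kappa A -> thick kappa (~` A).
Proof.
move=> nlA F Fs; apply: contrapT => nth; apply: nlA.
(* Adding [1] to [F] makes [b] itself lie outside [A]. *)
pose F1 := F `|` [set 1]; have F1s : small_sets kappa F1 := small_setU1 1 Fs.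
exists [set x^-1 | x in F1]; first exact: small_invg.
apply/seteqP; split=> // b _; apply: contrapT => bN; apply: nth.
have out f f' : F1 f -> F1 f' -> ~ A (f * b * f').
  move=> Ff Ff' Afbf; apply: bN; exists (b * f').
    by exists f^-1; [exists f|exists (f * b * f'); rewrite // !mulgA mulVg mul1g].
  by exists f'^-1; [exists f'|rewrite mulgK].
exists b.
  by have := out 1 1 (or_intror erefl) (or_intror erefl); rewrite mul1g mulg1.
by move=> _ [_ [f Ff [_ -> <-]] [f' Ff' <-]]; apply: out; left.
Qed.

(** * Unions of small sets in a normal group *)

(** Say [#|A| <= #|B|], and let [H] be a small normal subgroup that contains
    [B].  It is proper, so it has a coset [g H] disjoint from it, which has room
    for a copy of [A].  Any small normal subgroup [N] that contains [H] and [g]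
    also contains [g H], so that the union embeds into [N]. *)
Lemma small_setU_normal A B :
  [set: G] #= [set: kappa] -> normal_group kappa G ->
  small_sets kappa A -> small_sets kappa B -> small_sets kappa (A `|` B).
Proof.
move=> cardG nG; wlog AB : A B / A #<= B.
  move=> hwlog As Bs; have /orP[AB|BA] := card_le_total A B; first exact: hwlog.
  by rewrite setUC; exact: hwlog.
move=> As /nG[H [[Hg _] Hs BH]].
have [g NHg] : exists g, ~ H g.
  apply/existsNP => HT; have /andP[_ /negP[]] := Hs.
  by have -> : H = [set: G] by apply/seteqP; split => // x _; exact: HT.
have [N [[Ng _] Ns HgN]] := nG _ (small_setU1 g Hs).
have [i iB iinj] := card_le_inj_on AB.
have mulN x y : N x -> N y -> N (x * y).
  by move=> Nx Ny; apply/set_mem/(group_closedM Ng); apply/mem_set.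
pose h x := if pselect (B x) then x else g * i x.
have ABE x : (A `|` B) x -> ~ B x -> A x by case.
apply: card_le_lt_trans Ns; apply: (@inj_on_card_le _ _ _ _ h) => [x ABx|x y].
  rewrite /h; case: pselect => /= [/BH Hx|NBx].
    by apply: HgN; left.
  by apply: mulN; apply: HgN; [right|left; apply/BH/iB/ABE].
have neq u v : B u -> A v -> u <> g * i v.
  move=> /BH Hu /iB/BH Hiv ug; apply: NHg.
  have -> : g = u / i v by rewrite ug mulgK.
  by apply/set_mem/Hg.2; apply/mem_set.
move=> /set_mem/ABE Ax /set_mem/ABE Ay; rewrite /h.
case: pselect => /= [Bx|/Ax{}Ax]; case: pselect => /= [By|/Ay{}Ay] //.
- by move/(neq _ _ Bx Ay).
- by move/esym/(neq _ _ By Ax).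
- by move/mulgI/iinj; apply; exact: mem_set.
Qed.

End Thick.

(** * Groups of singular cardinality *)

Section Singular.
Variables (G : groupType) (kappa : cardinal).
Hypotheses (cardG : [set: G] #= [set: kappa]) (sing : singular kappa).
Implicit Types A B F H : set G.
Local Open Scope group_scope.

(** Singularity is what keeps the set of translating elements small: they are
    indexed by a cofinal set with fewer than [kappa] elements. *)
Lemma left_thick_right_large A :
  left_thick kappa A -> right_large kappa A.
Proof.
move=> lthA; have kinf := sing.1; have [C cofC Clt] := singular_cofinal sing.
have /card_eqP[f] := cardG.
pose k (g : G) : kappa := val (f (SigSub (mem_set (I : [set: G] g)))).
have kinj : injective k by move=> x y /val_inj/inj; rewrite !inE => /(_ I I)[].
pose H c := [set g | cle (k g) c].
have Hs c : small_sets kappa (H c).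
  apply: card_le_lt_trans (segment_lt c kinf).
  by apply: (@inj_on_card_le _ _ _ _ k) => // x y _ _ /kinj.
have /choice[a aP] : forall c, exists a, A a /\ mulset (H c) [set a] `<=` A.
  by move=> c; have [a] := lthA _ (Hs c); exists a.
exists ((fun c => (a c)^-1) @` C).
  exact: card_le_lt_trans (card_image_le _ _) Clt.
apply/seteqP; split=> // g _; have [c Cc gc] := cofC (k g).
exists (g * a c); first by apply: (aP c).2; exists g => //; exists (a c).
by exists (a c)^-1; [exists c|rewrite mulgK].
Qed.

(** Each step of the induction trades one set that is not large for a small
    factor [F] on the right of the other sets. *)
Lemma finite_cover_large n (A : 'I_n -> set G) :
  normal_group kappa G ->
  (forall g, exists i, A i g) -> exists i, large kappa (A i).
Proof.
have kinf := sing.1; move=> nG; elim: n A => [|n IH] A cov; first by have [[]] := cov 1.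
have [lA0|/(not_large_thick kinf)/(thick_left_thick kinf)] :=
    pselect (large kappa (A ord0)).
  by exists ord0.
move=> /left_thick_right_large[F Fs GF].
have [g|i [F' F's GE]] := IH (fun i => mulset (A (lift ord0 i)) F).
  have : [set: G] g by []; rewrite GF => -[a NA0a [f Ff <-]].
  have [i Aia] := cov a; case: (unliftP ord0 i) Aia => [j|] -> // Aja.
  by exists j; exists a => //; exists f.
have [E [[Eg _] Es FE]] := nG _ (small_setU_normal kinf cardG nG Fs F's).
have mulE x y : E x -> E y -> E (x * y).
  by move=> Ex Ey; apply/set_mem/(group_closedM Eg); apply/mem_set.
exists (lift ord0 i), E => //; apply/seteqP; split=> // g _.
have : [set: G] g by []; rewrite GE.
move=> -[_ [x F'x [_ [a Aa [f Ff <-]] <-]] [y F'y <-]].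
exists (x * a); first by exists x; [apply: FE; right|exists a].
by exists (f * y); [apply: mulE; apply: FE; [left|right]|rewrite !mulgA].
Qed.

End Singular.

Theorem theorem2 (G : groupType) (kappa : cardinal)
    (cardG : [set: G] #= [set: kappa]) (sing : singular kappa) :
  [/\ (forall A : set G, left_thick kappa A -> right_large kappa A),
      ~ (exists A : 'I_2 -> set G,
           partition [set: 'I_2] A [set: G] /\ (forall i, thick kappa (A i)))
    & (normal_group kappa G ->
       forall (n : nat) (A : 'I_n -> set G),
         partition [set: 'I_n] A [set: G] -> exists i, large kappa (A i))].
Proof.
have kinf : infinite_set [set: kappa] by case: sing.
split=> [A|[A [[_ triv _] thA]]|nG n A [cov _ _]].
- exact: (left_thick_right_large cardG sing).
- have lA0 : large kappa (A ord0).
    apply: right_large_large => //.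
    exact/(left_thick_right_large cardG sing)/thick_left_thick.
  have [a A0a A1a] := thick_meets_large lA0 (thA ord_max).
  by have := triv ord0 ord_max I I (ex_intro _ a (conj A0a A1a)).
- apply: (finite_cover_large cardG sing) => // g.
  by have : [set: G] g by []; rewrite -cov => -[i _ Aig]; exists i.
Qed.
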